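(* Let $S \subseteq \mathbb{R}^n_+$ and let $u \in \mathbb{R}^n_+$. Then the following are equivalent: (1) $u \in \operatorname{span}(S)$. (2) For each $j \in \operatorname{supp}(u)$ there is an $x^j \in S$ such that $j \in \operatorname{supp}(x^j)$ and $x^j(j) \le u(j)$ (componentwise).
   Context: $\mathbb{R}^n_+$ is the set of vectors with nonnegative real entries, ordered componentwise; $a\oplus b=\max(a,b)$, extended componentwise to vectors. For $S\subseteq\mathbb{R}^n_+$, $\operatorname{span}(S)$ is the set of all max combinations $\bigoplus_{x\in S}\lambda_x x$ with $\lambda_x\ge 0$ and only finitely many $\lambda_x\neq 0$; $\operatorname{span}(\emptyset)=\{0\}$. Subscripts denote entries, superscripts label vectors. $\operatorname{supp}(v)=\{j: v_j>0\}$. For $j\in\operatorname{supp}(v)$, $v(j)=v/v_j$. *)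

(* Defs.v *)
From mathcomp Require Import all_boot all_order all_algebra.
From mathcomp Require Import boolp classical_sets functions cardinality fsbigop.
From mathcomp Require Import reals.

Set Implicit Arguments.
Unset Strict Implicit.
Unset Printing Implicit Defensive.

Import Order.TTheory GRing.Theory Num.Theory.

Local Open Scope classical_set_scope.
Local Open Scope ring_scope.

Definition nonneg_orthant (R : realType) (n : nat) : set 'rV[R]_n :=
  [set x | forall i, 0 <= x 0 i].
Arguments nonneg_orthant R n _ : clear implicits.

Definition vec_le (R : realType) (n : nat) (x y : 'rV[R]_n) : Prop :=
  forall i, x 0 i <= y 0 i.

Definition vec_max (R : realType) (n : nat) (x y : 'rV[R]_n) : 'rV[R]_n :=
  \row_i Num.max (x 0 i) (y 0 i).

(* The values of [lambda] outside [S] are irrelevant.  The big operator ranges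
   over the x in S with lambda x *: x != 0, which are finitely many by the second
   condition; it yields 0 when there are none, so that max_span set0 = [set 0]. *)
Definition max_span (R : realType) (n : nat) (S : set 'rV[R]_n) : set 'rV[R]_n :=
  [set u | exists lambda : 'rV[R]_n -> R,
    [/\ forall x, S x -> 0 <= lambda x,
        finite_set [set x | S x /\ lambda x != 0]
      & u = \big[@vec_max R n/0]_(x \in S) (lambda x *: x)]].

Definition supp (R : realType) (n : nat) (v : 'rV[R]_n) : {set 'I_n} :=
  [set j | 0 < v 0 j]%SET.

(* The vector v(j) = v / v_j, meaningful when j \in supp v. *)
Definition normalize_at (R : realType) (n : nat) (v : 'rV[R]_n) (j : 'I_n) :
    'rV[R]_n :=
  (v 0 j)^-1 *: v.

(* Main.v *)
Require Import Defs.
From mathcomp Require Import all_boot all_order all_algebra.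
From mathcomp Require Import boolp classical_sets functions cardinality fsbigop.
From mathcomp Require Import reals.

Import Order.TTheory GRing.Theory Num.Theory.

Local Open Scope classical_set_scope.
Local Open Scope ring_scope.

(** For [x] and [u] with positive [j]-th entries, [x(j) <= u(j)] says exactly
    that the multiple [(u_j / x_j) x] of [x], which agrees with [u] at [j], lies
    below [u].  A max combination equal to [u] attains each positive entry [u_j]
    at one of its terms, and that term is such a multiple; conversely the
    maximum over [j] of the multiples [(u_j / x^j_j) x^j] is [u]. *)

Lemma vec_le_normalize_at (R : realType) (n : nat) (x u : 'rV[R]_n) (j : 'I_n) :
  0 < x 0 j -> 0 < u 0 j ->
  vec_le (normalize_at x j) (normalize_at u j) <->
  vec_le ((u 0 j / x 0 j) *: x) u.
Proof.
move=> xj uj; split=> le_xu i; move: (le_xu i); rewrite !mxE.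
  by rewrite [X in _ <= X]mulrC ler_pdivlMr // mulrC mulrA.
by rewrite [X in _ -> _ <= X]mulrC ler_pdivlMr // [X in _ -> X <= _]mulrC mulrA.
Qed.

Lemma big_vec_maxE (R : realType) (n : nat) (I : Type) (s : seq I)
    (F : I -> 'rV[R]_n) (i : 'I_n) :
  (\big[@vec_max R n/0]_(x <- s) F x) 0 i = \big[Num.max/0]_(x <- s) F x 0 i.
Proof.
by apply: (big_morph (fun v : 'rV[R]_n => v 0 i)) => [v w|]; rewrite mxE.
Qed.

(** The strict inequality excludes the default value [a], which the maximum could take without any
    term attaining it. *)
Lemma bigmax_gt_attained (d : Order.disp_t) (T : orderType d) (I : eqType)
    (a : T) (s : seq I) (f : I -> T) :
  (a < \big[Order.max/a]_(x <- s) f x)%O ->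
  exists2 x, x \in s & \big[Order.max/a]_(x <- s) f x = f x.
Proof.
elim: s => [|y s IHs]; first by rewrite big_nil ltxx.
rewrite big_cons; case: (leP (f y)) => _ lt_a; last by exists y; rewrite ?mem_head.
by have [x xs ->] := IHs lt_a; exists x; rewrite // in_cons xs orbT.
Qed.

(** A nonzero [lambda x *: x] forces [lambda x != 0], so the support is finite and [finite_support]
    does not fall back to the empty sequence. *)
Lemma in_finite_support_scale (R : realType) (n : nat) (S : set 'rV[R]_n)
    (lambda : 'rV[R]_n -> R) (x : 'rV[R]_n) :
  finite_set [set x | S x /\ lambda x != 0] ->
  (x \in finite_support 0 S (fun x => lambda x *: x)) <->
  S x /\ lambda x *: x != 0.
Proof.
move=> fin_lambda; rewrite in_finite_support; last first.
  apply: sub_finite_set fin_lambda => y [Sy /= /eqP].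
  by rewrite scaler_eq0 negb_or => /andP[].
by rewrite inE; split=> -[Sx /eqP].
Qed.

Lemma max_span_normalize_le (R : realType) (n : nat) (S : set 'rV[R]_n)
    (u : 'rV[R]_n) (j : 'I_n) :
  S `<=` nonneg_orthant R n -> max_span S u -> j \in supp u ->
  exists x : 'rV[R]_n,
    [/\ S x, j \in supp x & vec_le (normalize_at x j) (normalize_at u j)].
Proof.
move=> nonnegS [lambda [lambda_ge0 fin_lambda ->]]; set s := finite_support _ _ _.
rewrite finset.in_set => uj; have := uj; rewrite big_vec_maxE.
move=> /bigmax_gt_attained[x xs]; rewrite -big_vec_maxE => uE.
have [Sx _] := (in_finite_support_scale _ _ _ _ _ fin_lambda).1 xs.
have xj : 0 < x 0 j.
  rewrite lt_neqAle nonnegS // andbT eq_sym; apply/eqP => xj0.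
  by move: uj; rewrite uE mxE xj0 mulr0 ltxx.
exists x; split; rewrite ?finset.in_set //; apply/vec_le_normalize_at => // i.
(* Since [x] attains the maximum at [j], the ratio of the two [j]-th entries is [lambda x]; it
   remains to bound one term by the maximum. *)
rewrite uE big_vec_maxE !mxE mulfK ?gt_eqF //.
apply: (bigmax_sup_seq _ x) => //; by rewrite !mxE.
Qed.

Lemma normalize_le_max_span (R : realType) (n : nat) (S : set 'rV[R]_n)
    (u : 'rV[R]_n) :
  nonneg_orthant R n u ->
  (forall j : 'I_n, j \in supp u ->
     exists x : 'rV[R]_n,
       [/\ S x, j \in supp x & vec_le (normalize_at x j) (normalize_at u j)]) ->
  max_span S u.
Proof.
move=> nonneg_u hyp.
(* [choice] needs a total relation: indices outside the support of [u] get the dummy vector [0]. *)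
have /choice[f fP] : forall j, exists x : 'rV[R]_n, 0 < u 0 j ->
    [/\ S x, 0 < x 0 j & vec_le ((u 0 j / x 0 j) *: x) u].
  move=> j.
  have [uj|_] := boolP (0 < u 0 j); last by exists 0.
  have [|x [Sx]] := hyp j; first by rewrite finset.in_set.
  rewrite finset.in_set => xj /vec_le_normalize_at le_xu.
  by exists x; split; last exact: le_xu.
(* Several indices [j] may share the same [f j], hence the inner maximum. *)
pose lambda x := \big[Num.max/0]_(j | (0 < u 0 j) && (f j == x)) (u 0 j / x 0 j).
have lambda_ge0 x : 0 <= lambda x by apply: bigmax_ge_id.
have lambda_attained x : lambda x != 0 ->
    exists j, [/\ 0 < u 0 j, f j = x & lambda x = u 0 j / x 0 j].
  move=> lambda_neq0.
  have : 0 < lambda x by rewrite lt_neqAle eq_sym lambda_neq0 lambda_ge0.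
  rewrite /lambda -big_filter => /bigmax_gt_attained[j].
  by rewrite mem_filter => /andP[/andP[uj /eqP fj] _] ->; exists j.
have fin_lambda : finite_set [set x | S x /\ lambda x != 0].
  (* A nonzero coefficient occurs only on the image of the finite index type under [f]. *)
  apply: (@sub_finite_set _ _ (f @` setT)); last exact: finite_image.
  by move=> x [_ /lambda_attained[j [_ <- _]]]; exists j.
exists lambda; split=> //; apply/rowP => i; rewrite big_vec_maxE.
apply/le_anti/andP; split.
  have [ui|] := ltP 0 (u 0 i); last by move=> /le_trans->//; apply: bigmax_ge_id.
  have [Sfi fi _] := fP i ui.
  have le_u : u 0 i <= (lambda (f i) *: f i) 0 i.
    by rewrite mxE -ler_pdivrMr //; apply: (bigmax_sup i); rewrite ?ui ?eqxx.
  (* The term at [f i] does occur in the big maximum: its [i]-th entry is at least [u 0 i > 0], so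
     it is nonzero. *)
  apply: (bigmax_sup_seq _ (f i)) => //.
  apply/in_finite_support_scale => //; split=> //.
  apply/eqP => fi0; move: le_u; rewrite fi0 mxE.
  by rewrite leNgt ui.
(* Each nonzero coefficient equals a single ratio [u 0 j / x 0 j] with [f j = x], and that multiple
   of [x] lies below [u] by the choice of [f]. *)
apply: bigmax_le => // x _; rewrite mxE.
have [->|] := eqVneq (lambda x) 0; first by rewrite mul0r nonneg_u.
move=> /lambda_attained[j [uj <- ->]].
by have [_ _ /(_ i)] := fP j uj; rewrite mxE.
Qed.

Theorem mainTheorem1 (R : realType) (n : nat) (S : set 'rV[R]_n) (u : 'rV[R]_n)
    (hS : S `<=` nonneg_orthant R n) (hu : nonneg_orthant R n u) :
  max_span S u <->
  (forall j : 'I_n, j \in supp u ->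
     exists x : 'rV[R]_n,
       [/\ S x, j \in supp x & vec_le (normalize_at x j) (normalize_at u j)]).
Proof.
split=> [uS j|]; first exact: max_span_normalize_le.
exact: normalize_le_max_span.
Qed.
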